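(* For every odd prime number $p \geq 3$, there exist infinitely many pairs of imaginary quadratic fields $\mathbb{Q}(\sqrt{d})$ and $\mathbb{Q}(\sqrt{d+1})$, with $d \in \mathbb{Z}$, such that the class numbers of both $\mathbb{Q}(\sqrt{d})$ and $\mathbb{Q}(\sqrt{d+1})$ are divisible by $p$. *)

(* Defs.v *)
From mathcomp Require Import all_boot all_order all_algebra all_field.
From mathcomp Require Import all_classical.

Set Implicit Arguments.
Unset Strict Implicit.
Unset Printing Implicit Defensive.

Import GRing.Theory Num.Theory.
Local Open Scope classical_set_scope.
Local Open Scope ring_scope.

(* Number fields are subfields of [algC], given by their underlying sets, so
   that equality of fields is equality of sets. *)

Definition quadratic_field (d : int) : set algC :=
  [set x | exists a b : rat, x = ratr a + ratr b * sqrtC d%:~R].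

Definition ring_of_integers (K : set algC) : set algC :=
  [set x | K x /\ x \in Aint].

(* [I] is a nonzero fractional ideal of the ring of integers of [K].  Closure
   under 0 and opposite follows from closure under multiplication by integers
   of [K]. *)
Definition fractional_ideal (K I : set algC) : Prop :=
  [/\ I `<=` K,
      exists2 x, I x & x != 0,
      forall x y, I x -> I y -> I (x + y),
      forall a x, ring_of_integers K a -> I x -> I (a * x) &
      exists c, [/\ ring_of_integers K c, c != 0 &
                    forall x, I x -> ring_of_integers K (c * x)]].

(* The coset of [I] modulo the group of principal fractional ideals. *)
Definition ideal_class (K I : set algC) : set (set algC) :=
  [set J | exists a, [/\ K a, a != 0 & J = [set a * x | x in I]]].

Definition class_group (K : set algC) : set (set (set algC)) :=
  [set ideal_class K I | I in fractional_ideal K].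

(* The class group is finite of order [h]; a relation rather than a function, so
   that no junk value is attached to an infinite class group. *)
Definition has_class_number (K : set algC) (h : nat) : Prop :=
  (class_group K #= `I_h)%card.

Definition class_number_divisible_by (p : nat) (K : set algC) : Prop :=
  exists2 h : nat, has_class_number K h & (p %| h)%N.

(* Main.v *)
Require Import Defs.
From mathcomp Require Import all_boot all_order all_algebra all_field.
From mathcomp Require Import all_fingroup all_solvable.
From mathcomp Require Import all_classical.
From mathcomp Require Import zify ring lra.

Set Implicit Arguments.
Unset Strict Implicit.
Unset Printing Implicit Defensive.

Import Order.TTheory GRing.Theory Num.Theory.
Local Open Scope classical_set_scope.
Local Open Scope ring_scope.

(** For [K = Q(sqrt(1 - 4 V^p))] the integer [a = (1 + sqrt(1 - 4 V^p)) / 2] has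
    trace 1 and norm [V^p], so the ideal [I = (a, V)] satisfies [I^p = (a)], and
    multiplication by [I] permutes the class group with order dividing [p].  If
    [I J = c J] for some fractional ideal [J] then [a J = c^p J], so [a / c^p] is a
    unit; when [V] is not 1 modulo 3, [K] does not contain [sqrt(-3)] and every
    unit is a [p]-th power, hence [a = g^p].  The trace of [g] divides 1 and its
    norm is [V], and computing the trace of [g^p] modulo [V^2] contradicts
    [V > p].  The permutation thus has no fixed point and [p] divides the class
    number, which is finite by Hurwitz's argument.

    Now put [U = 4 V^p - 1] and [d = - 4 U^p].  Up to squares [d] is
    [- U = 1 - 4 V^p], while [d + 1 = 1 - 4 U^p], so both fields are of the
    form above.  Infinitely many fields arise because [V] can be chosen such that
    an arbitrarily large prime divides [U] exactly once. *)

(** * Arithmetic of imaginary quadratic fields *)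

Lemma conj_sqrtC_neg (d : int) :
  d < 0 -> (sqrtC d%:~R : algC)^* = - sqrtC d%:~R.
Proof.
move=> d_lt0; set w := sqrtC _.
have w2 : w ^+ 2 = d%:~R by rewrite sqrtCK.
have : w^* ^+ 2 == w ^+ 2.
  by rewrite -rmorphXn w2 rmorph_int.
rewrite eqf_sqr => /orP[/eqP w_real|/eqP //].
have : w ^+ 2 < 0 by rewrite w2 ltrz0.
by rewrite real_exprn_even_lt0 // CrealE w_real eqxx.
Qed.

Lemma quadratic_fieldE (d : int) (x : algC) : quadratic_field d x <->
  exists a b, [/\ a \in Crat, b \in Crat & x = a + b * sqrtC d%:~R].
Proof.
split=> [[a [b ->]]|[_ [_ [/CratP[a ->] /CratP[b ->] ->]]]]; last by exists a, b.
by exists (ratr a), (ratr b); split=> //; apply/CratP; [exists a|exists b].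
Qed.

Lemma quadratic_field_rat (d : int) (x : algC) :
  x \in Crat -> quadratic_field d x.
Proof.
move=> Qx; apply/quadratic_fieldE; exists x, 0.
by rewrite rpred0 mul0r addr0.
Qed.

Lemma quadratic_field_sqrt (d : int) : quadratic_field d (sqrtC d%:~R).
Proof.
apply/quadratic_fieldE; exists 0, 1.
by rewrite rpred0 rpred1 mul1r add0r.
Qed.

Lemma quadratic_fieldD (d : int) (x y : algC) :
  quadratic_field d x -> quadratic_field d y -> quadratic_field d (x + y).
Proof.
move=> /quadratic_fieldE[a [b [Qa Qb ->]]] /quadratic_fieldE[u [v [Qu Qv ->]]].
apply/quadratic_fieldE; exists (a + u), (b + v).
by rewrite !rpredD //; split=> //; ring.
Qed.

Lemma quadratic_fieldM (d : int) (x y : algC) :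
  quadratic_field d x -> quadratic_field d y -> quadratic_field d (x * y).
Proof.
move=> /quadratic_fieldE[a [b [Qa Qb ->]]] /quadratic_fieldE[u [v [Qu Qv ->]]].
apply/quadratic_fieldE; exists (a * u + b * v * d%:~R), (a * v + b * u).
have Qd : (d%:~R : algC) \in Crat by rewrite rpred_int.
rewrite !(rpredD, rpredM) //; split=> //.
have w2 := sqrtCK (d%:~R : algC); ring: w2.
Qed.

Lemma quadratic_fieldX (d : int) (x : algC) (n : nat) :
  quadratic_field d x -> quadratic_field d (x ^+ n).
Proof.
move=> Kx; elim: n => [|n IHn]; first by apply: quadratic_field_rat; rewrite rpred1.
by rewrite exprS; apply: quadratic_fieldM.
Qed.

Lemma quadratic_field_conj (d : int) (x : algC) :
  d < 0 -> quadratic_field d x -> quadratic_field d x^*.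
Proof.
move=> d_lt0 /quadratic_fieldE[a [b [Qa Qb ->]]].
apply/quadratic_fieldE; exists a, (- b); rewrite rpredN; split=> //.
by rewrite rmorphD rmorphM /= conj_sqrtC_neg // !conj_Crat // mulrN mulNr.
Qed.

Lemma quadratic_field_trace (d : int) (x : algC) :
  d < 0 -> quadratic_field d x -> x + x^* \in Crat.
Proof.
move=> d_lt0 /quadratic_fieldE[a [b [Qa Qb ->]]].
rewrite rmorphD rmorphM /= conj_sqrtC_neg // !conj_Crat //.
by rewrite (_ : _ + _ = a + a) ?rpredD //; ring.
Qed.

Lemma quadratic_norm_coordinates (d : int) (a b : algC) :
  d < 0 -> a \in Crat -> b \in Crat ->
  (a + b * sqrtC d%:~R) * (a + b * sqrtC d%:~R)^* = a ^+ 2 - b ^+ 2 * d%:~R.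
Proof.
move=> d_lt0 Qa Qb; have w2 := sqrtCK (d%:~R : algC).
by rewrite rmorphD rmorphM /= conj_sqrtC_neg // !conj_Crat //; ring: w2.
Qed.

Lemma quadratic_field_norm (d : int) (x : algC) :
  d < 0 -> quadratic_field d x -> x * x^* \in Crat.
Proof.
move=> d_lt0 /quadratic_fieldE[a [b [Qa Qb ->]]].
by rewrite quadratic_norm_coordinates // rpredB ?rpredM ?rpredX ?rpred_int.
Qed.

Lemma quadratic_fieldV (d : int) (x : algC) :
  d < 0 -> quadratic_field d x -> quadratic_field d x^-1.
Proof.
move=> d_lt0 Kx; rewrite invC_norm; apply: quadratic_fieldM.
  by apply: quadratic_field_rat; rewrite rpredV normCK (quadratic_field_norm d_lt0).
exact: quadratic_field_conj.
Qed.

(** * Algebraic integers and stabilizers of ideals *)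

Lemma quadratic_integer_trace (d : int) (x : algC) : d < 0 ->
  quadratic_field d x -> x \in Aint -> x + x^* \is a Num.int.
Proof.
move=> d_lt0 Kx Ax; apply: Cint_rat_Aint; first exact: quadratic_field_trace Kx.
by rewrite rpredD // Aint_aut.
Qed.

Lemma quadratic_integer_norm (d : int) (x : algC) : d < 0 ->
  quadratic_field d x -> x \in Aint -> x * x^* \is a Num.int.
Proof.
move=> d_lt0 Kx Ax; apply: Cint_rat_Aint; first exact: quadratic_field_norm Kx.
by rewrite rpredM // Aint_aut.
Qed.

Lemma Aint_trace_norm (x : algC) :
  x + x^* \is a Num.int -> x * x^* \is a Num.int -> x \in Aint.
Proof.
move=> Zt Zn; pose q : {poly algC} := ('X - x%:P) * ('X - x^*%:P).
have qE : q = 'X^2 - (x + x^*) *: 'X + (x * x^*)%:P.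
  by rewrite /q -mul_polyC !polyCD !polyCM; ring.
have qZ : q \is a polyOver Num.int_num_subdef.
  rewrite qE; apply: rpredD; last by rewrite polyOverC.
  by apply: rpredB; [rewrite rpredX // polyOverX|rewrite polyOverZ // polyOverX].
apply: root_monic_Aint qZ; first by rewrite rootM root_XsubC eqxx.
by rewrite rpredM ?monicXsubC.
Qed.

(** Substituting ['X^n] into the minimal polynomial of [x ^+ n] gives a monic integral polynomial
    with root [x]. *)
Lemma Aint_root_exp (x : algC) (n : nat) :
  (0 < n)%N -> x ^+ n \in Aint -> x \in Aint.
Proof.
move=> n_gt0 Axn; have q_root := root_minCpoly (x ^+ n).
have /monicP q_monic := minCpoly_monic (x ^+ n).
have {Axn} : minCpoly (x ^+ n) \is a polyOver Num.int_num_subdef by exact: Axn.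
move: (minCpoly _) q_root q_monic => q q_root q_monic Zq.
have Zqn : q \Po 'X^n \is a polyOver Num.int_num_subdef.
  by apply: polyOver_comp => //; apply: polyOverXn.
apply: root_monic_Aint Zqn; first by rewrite root_comp hornerXn.
by rewrite monicE lead_coef_comp ?size_polyXn // q_monic lead_coefXn expr1n mulr1.
Qed.

(** If [N] has denominator [D] in lowest terms, integrality of [E * N ^+ n] forces [D ^ n] to divide
    the fixed nonzero integer [E] for every [n]; hence [D = 1]. *)
Lemma Cint_bounded_denominators (E N : algC) : N \in Crat -> E != 0 ->
  (forall n, E * N ^+ n \is a Num.int) -> N \is a Num.int.
Proof.
move=> /CratP[r ->] E0 ZE.
have /intrP[e eE] := ZE 0; rewrite expr0 mulr1 in eE.
have e0 : e != 0 by rewrite eE intr_eq0 in E0.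
have dvd_e n : (denq r ^+ n %| e)%Z.
  have /intrP[z zE] := ZE n.
  have er : e%:~R * r ^+ n = z%:~R :> rat.
    by apply: (fmorph_inj (@ratr algC)); rewrite rmorphM rmorphXn /= !ratr_int -eE.
  have eqz : e * numq r ^+ n = z * denq r ^+ n.
    apply: (@intr_inj rat); rewrite [LHS]rmorphM [RHS]rmorphM /=.
    by rewrite [X in _ * X = _]rmorphXn [X in _ = _ * X]rmorphXn /= numqE exprMn mulrA er.
  rewrite -(@Gauss_dvdzl _ _ (numq r ^+ n)) ?eqz ?dvdz_mull //.
  rewrite coprimezE !abszX coprimeXl // coprimeXr // coprime_sym.
  exact: coprime_num_den.
have [d1|] := eqVneq (denq r) 1.
  by rewrite -[r]divq_num_den d1 divr1 ratr_int rpred_int.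
move=> d1; exfalso.
have d2 : (1 < `|denq r|)%N by have := denq_gt0 r; move: d1; lia.
(* The exponent [|e|] suffices, as [k < D ^ k] whenever [D > 1]. *)
have := dvd_e `|e|%N; rewrite dvdzE abszX => /dvdn_leq.
rewrite absz_gt0 e0 => /(_ isT); rewrite leqNgt => /negP; apply.
exact: ltn_expl.
Qed.

Lemma ring_of_integers_int (d u v : int) :
  ring_of_integers (quadratic_field d) (u%:~R + v%:~R * sqrtC d%:~R).
Proof.
split.
  by apply/quadratic_fieldE; exists u%:~R, v%:~R; rewrite !rpred_int.
rewrite rpredD ?rpredM ?Aint_int //.
by apply: (@Aint_root_exp _ 2) => //; rewrite sqrtCK Aint_int.
Qed.

Lemma ring_of_integers1 (d : int) : ring_of_integers (quadratic_field d) 1.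
Proof. by have := ring_of_integers_int d 1 0; rewrite mul0r addr0. Qed.

Lemma ring_of_integersz (d z : int) :
  ring_of_integers (quadratic_field d) z%:~R.
Proof. by have := ring_of_integers_int d z 0; rewrite mul0r addr0. Qed.

(* The norm of [x] is an integer since its powers have bounded denominators;
   applying this to [x + 1] too gives the trace. *)
Lemma fractional_ideal_stabilizer (d : int) (J : set algC) (x : algC) :
  d < 0 -> fractional_ideal (quadratic_field d) J -> quadratic_field d x ->
  (forall y, J y -> J (x * y)) -> x \in Aint.
Proof.
move=> d_lt0 [JK [j Jj j0] JD JM [c [[Kc Ac] c0 cJ]]].
have norm_int z : quadratic_field d z -> (forall y, J y -> J (z * y)) ->
    z * z^* \is a Num.int.
  move=> Kz zJ; have Jzn n : J (z ^+ n * j).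
    by elim: n => [|n IHn]; rewrite ?mul1r // exprS -mulrA; apply: zJ.
  apply: (@Cint_bounded_denominators ((c * j) * (c * j)^*)).
  - exact: quadratic_field_norm Kz.
  - by rewrite mulf_neq0 ?conjC_eq0 ?mulf_neq0.
  move=> n; have [Kn An] := cJ _ (Jzn n).
  have := quadratic_integer_norm d_lt0 Kn An.
  rewrite !rmorphM rmorphXn /= exprMn.
  by congr (_ \is a _); ring.
move=> Kx xJ; have Zx := norm_int x Kx xJ.
have Zx1 : (x + 1) * (x + 1)^* \is a Num.int.
  apply: norm_int.
    by apply: quadratic_fieldD => //; case: (ring_of_integers1 d).
  by move=> y Jy; rewrite mulrDl mul1r; apply: JD => //; apply: xJ.
apply: Aint_trace_norm => //.
rewrite (_ : x + x^* = (x + 1) * (x + 1)^* - x * x^* - 1).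
  by rewrite !rpredB ?rpred1.
by rewrite rmorphD rmorph1; ring.
Qed.

(** * Finiteness of the class group *)

(** Dirichlet's pigeonhole argument: for the [N ^ 2 + 1] values [k <= N ^ 2], the pairs of
    fractional parts of [k a] and [k b] lie in [N ^ 2] square cells of side [1 / N]. Two of them
    share a cell, and [m] is the difference of their indices. *)
Lemma simultaneous_approximation (a b : rat) (N : nat) : (0 < N)%N ->
  exists m (u v : int), [/\ (0 < m <= N ^ 2)%N,
    `|m%:R * a - u%:~R| * N%:R < 1 & `|m%:R * b - v%:~R| * N%:R < 1].
Proof.
case: N => // N _; set n := N.+1.
pose fr (c : rat) (k : nat) := k%:R * c - (Num.floor (k%:R * c))%:~R.
pose cell c k := Num.floor (fr c k * n%:R).
have frP c k : 0 <= fr c k < 1.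
  have /andP[] := floor_itv (k%:R * c); rewrite /fr intrD; lra.
have n_gt0 : 0 < n%:R :> rat by rewrite ltr0n.
have cellP c k : 0 <= cell c k < n%:Z.
  have /andP[f0 f1] := frP c k.
  rewrite floor_ge0 floor_lt_int mulr_ge0 ?ler0n //=.
  by rewrite -[X in _ < X]mul1r ltr_pM2r.
have cell_close c k l : cell c k = cell c l -> `|fr c k - fr c l| * n%:R < 1.
  move=> ckl; rewrite -[n%:R]ger0_norm ?ler0n // -normrM mulrBl.
  have /andP[] := floor_itv (fr c k * n%:R).
  have /andP[] := floor_itv (fr c l * n%:R).
  rewrite -/(cell c k) -/(cell c l) ckl intrD ltr_norml; lra.
pose g (k : 'I_(n ^ 2).+1) : 'I_n * 'I_n :=
  (inord `|cell a k|, inord `|cell b k|).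
have /injectivePn[k0 [l0 kl0 gkl]] : ~~ injectiveb g.
  apply/negP => /injectiveP /leq_card.
  by rewrite card_prod !card_ord mulnn ltnn.
have [k [l [kl [ca cb]]]] : exists k l : 'I_(n ^ 2).+1,
    (k < l)%N /\ cell a k = cell a l /\ cell b k = cell b l.
  have E c : inord `|cell c k0| = inord `|cell c l0| :> 'I_n ->
      cell c k0 = cell c l0.
    have /andP[? ?] := cellP c k0; have /andP[? ?] := cellP c l0.
    by move=> /(congr1 val); rewrite /= !inordK; lia.
  case: gkl => /E ca /E cb.
  case: (ltngtP k0 l0) => // [kl|kl|/val_inj kl].
  - by exists k0, l0.
  - by exists l0, k0.
  - by rewrite kl eqxx in kl0.
exists (l - k)%N, (Num.floor (l%:R * a) - Num.floor (k%:R * a)),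
  (Num.floor (l%:R * b) - Num.floor (k%:R * b)).
have E c : (l - k)%:R * c - (Num.floor (l%:R * c) - Num.floor (k%:R * c))%:~R =
    fr c l - fr c k.
  by rewrite /fr intrB natrB ?(ltnW kl) //; ring.
rewrite !E; split; [have := ltn_ord l; lia|exact/cell_close|exact/cell_close].
Qed.

(* Hurwitz's substitute for the division algorithm. *)
Lemma quadratic_approximation (d : int) : d < 0 ->
  exists M : nat, forall x, quadratic_field d x ->
  exists m b, [/\ (0 < m <= M)%N, ring_of_integers (quadratic_field d) b &
                  `|m%:R * x - b| < 1].
Proof.
(* With [|s|, |r| < 1 / N] the norm [s ^+ 2 + |d| r ^+ 2] is below [(1 + |d|) / N ^ 2 = 1 / N],
   hence this choice of [N]. *)
move=> d_lt0; pose N := `|d|.+1; exists (N ^ 2)%N => _ [a [b ->]].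
have [m [u [v [mM ua vb]]]] := simultaneous_approximation a b (ltn0Sn `|d|).
exists m, (u%:~R + v%:~R * sqrtC d%:~R); split => //.
  exact: ring_of_integers_int.
set s := _ - _ in ua; set r := _ - _ in vb.
set w := sqrtC _.
have -> : m%:R * (ratr a + ratr b * w) - (u%:~R + v%:~R * w) =
    ratr s + ratr r * w :> algC.
  by rewrite /s /r !rmorphB !rmorphM /= !ratr_int !ratr_nat; ring.
clearbody s r; rewrite -(@expr_lt1 _ 2) // normCK quadratic_norm_coordinates ?Crat_rat //.
have -> : (ratr s) ^+ 2 - (ratr r) ^+ 2 * d%:~R =
    ratr (s ^+ 2 - r ^+ 2 * d%:~R) :> algC.
  by rewrite rmorphB rmorphXn /= rmorphM rmorphXn /= ratr_int.
rewrite -(rmorph1 (@ratr algC)) ltr_rat.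
have nE : N%:R = 1 - d%:~R :> rat.
  by rewrite -natr1 natr_absz ltr0_norm // mulrNz addrC.
have sq_lt (y : rat) : `|y| * N%:R < 1 -> y ^+ 2 * N%:R ^+ 2 < 1.
  move=> y1; have : (`|y| * N%:R) ^+ 2 < 1.
    by rewrite expr_lt1 // mulr_ge0 ?ler0n.
  by rewrite exprMn real_normK ?num_real.
have := sq_lt _ ua; have := sq_lt _ vb; rewrite nE.
have : d%:~R <= -1 :> rat by rewrite -[-1]/((-1)%:~R) ler_int; lia.
move: (s ^+ 2) (sqr_ge0 s) (r ^+ 2) (sqr_ge0 r) (d%:~R : rat).
move=> S S0 R R0 D D1 RD SD.
have D0 : 0 < (1 - D) ^+ 2 by apply: exprn_gt0; lra.
rewrite -(ltr_pM2r D0).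
have -> : (S - R * D) * (1 - D) ^+ 2 = S * (1 - D) ^+ 2 - D * (R * (1 - D) ^+ 2).
  by ring.
nra.
Qed.

(** Multiplying by a common denominator [c] turns all squared absolute values into natural numbers,
    among which a least nonzero one exists. *)
Lemma fractional_ideal_minimal (d : int) (I : set algC) :
  d < 0 -> fractional_ideal (quadratic_field d) I ->
  exists x, [/\ I x, x != 0 & forall y, I y -> `|y| < `|x| -> y = 0].
Proof.
move=> d_lt0 [IK [j Ij j0] ID IM [c [[Kc Ac] c0 cI]]].
have natN y : I y -> exists n : nat, `|c * y| ^+ 2 = n%:R.
  move=> Iy; have [Ky Ay] := cI _ Iy; apply/natrP.
  rewrite natrEint exprn_ge0 // andbT normCK.
  exact: quadratic_integer_norm Ky Ay.
pose P n := `[< exists y, [/\ I y, y != 0 & `|c * y| ^+ 2 = n%:R] >].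
have exP : exists n, P n.
  by have [n jn] := natN _ Ij; exists n; apply/asboolP; exists j.
case: (ex_minnP exP) => n /asboolP[x [Ix x0 xn]] min_n.
exists x; split=> // y Iy yx; apply/eqP/negPn/negP => y0.
have [k yk] := natN _ Iy.
have /min_n : P k by apply/asboolP; exists y.
rewrite leqNgt => /negP; apply; rewrite -(ltr_nat algC) -xn -yk.
by rewrite ltrXn2r ?nnegrE // !normrM ltr_pM2l ?normr_gt0.
Qed.

Lemma fractional_idealN (d : int) (I : set algC) (x : algC) :
  fractional_ideal (quadratic_field d) I -> I x -> I (- x).
Proof.
move=> [_ _ _ IM _] Ix; rewrite -mulN1r; apply: IM => //.
exact: ring_of_integersz d (-1).
Qed.

Lemma quadratic_field_denominator (d : int) (x : algC) :
  quadratic_field d x -> exists2 n : nat, (0 < n)%N &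
  ring_of_integers (quadratic_field d) (n%:R * x).
Proof.
move=> [a [b ->]]; exists (`|denq a| * `|denq b|)%N.
  by rewrite muln_gt0 !absz_gt0 !denq_eq0.
have -> : (`|denq a| * `|denq b|)%:R * (ratr a + ratr b * sqrtC d%:~R) =
    (numq a * denq b)%:~R + (denq a * numq b)%:~R * sqrtC d%:~R :> algC.
  have numE c : (numq c)%:~R = ratr c * (denq c)%:~R :> algC.
    by rewrite -[LHS]ratr_int numqE rmorphM /= ratr_int.
  by rewrite !intrM !numE natrM !pmulrn !absz_denq; ring.
exact: ring_of_integers_int.
Qed.

Lemma fractional_ideal_scale (d : int) (I : set algC) (a : algC) : d < 0 ->
  quadratic_field d a -> a != 0 -> fractional_ideal (quadratic_field d) I ->
  fractional_ideal (quadratic_field d) [set a * x | x in I].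
Proof.
move=> d_lt0 Ka a0 [IK [j Ij j0] ID IM [c [[Kc Ac] c0 cI]]]; split.
- by move=> _ [x Ix <-]; apply: quadratic_fieldM => //; apply: IK.
- by exists (a * j); [exists j|rewrite mulf_neq0].
- by move=> _ _ [x Ix <-] [y Iy <-]; rewrite -mulrDr; exists (x + y) => //; apply: ID.
- by move=> b _ Ob [x Ix <-]; exists (b * x); [exact: IM|rewrite mulrCA].
have [n n_gt0 [Kna Ana]] := quadratic_field_denominator Ka.
exists (c * n%:R); split; last move=> _ [x Ix <-].
- split; last by rewrite rpredM ?rpred_nat.
  by apply: quadratic_fieldM => //; apply: quadratic_field_rat; rewrite rpred_nat.
- by rewrite mulf_neq0 // pnatr_eq0 -lt0n.
have [Kcx Acx] := cI _ Ix.
have -> : c * n%:R * (a * x) = (n%:R * a) * (c * x) by ring.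
by split; [exact: quadratic_fieldM|rewrite rpredM].
Qed.

Lemma ideal_class_scale (d : int) (I : set algC) (a : algC) : d < 0 ->
  quadratic_field d a -> a != 0 ->
  ideal_class (quadratic_field d) [set a * x | x in I] =
  ideal_class (quadratic_field d) I.
Proof.
move=> d_lt0 Ka a0; apply/seteqP; split=> J [b [Kb b0 ->]].
  exists (b * a); split; rewrite ?mulf_neq0 //; first exact: quadratic_fieldM.
  by rewrite image_comp; apply: eq_imagel => x _ /=; rewrite mulrA.
exists (b / a); split; rewrite ?mulf_neq0 ?invr_eq0 //.
  by apply: quadratic_fieldM => //; apply: quadratic_fieldV.
by rewrite image_comp; apply: eq_imagel => x _ /=; rewrite mulrA divfK.
Qed.

(** The crude denominator [2 |d|] avoids determining an integral basis. It comes from the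
    integrality of [x + x^*] and of [2 b d], where [x = a + b w]. *)
Lemma ring_of_integers_coordinates (d : int) (x : algC) : d < 0 ->
  ring_of_integers (quadratic_field d) x ->
  exists u v : int, (2 * `|d|)%:R * x = u%:~R + v%:~R * sqrtC d%:~R.
Proof.
move=> d_lt0 [Kx Ax]; have /intrP[t tE] := quadratic_integer_trace d_lt0 Kx Ax.
have /quadratic_fieldE[a [b [Qa Qb xE]]] := Kx; set w := sqrtC _ in xE *.
have wC : w^* = - w := conj_sqrtC_neg d_lt0.
have xC : x^* = a - b * w.
  by rewrite xE rmorphD rmorphM /= wC !conj_Crat // mulrN.
have w2 : w ^+ 2 = d%:~R := sqrtCK _.
have Aw : w \in Aint by apply: (@Aint_root_exp _ 2) => //; rewrite w2 Aint_int.
have bE : (x - x^*) * w = 2 * b * d%:~R by rewrite xC xE; ring: w2.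
have /intrP[z zE] : 2 * b * d%:~R \is a Num.int.
  apply: Cint_rat_Aint; first by rewrite !rpredM ?rpred_int ?rpred_nat.
  by rewrite -bE rpredM // rpredB // Aint_aut.
exists (- d * t), (- z).
rewrite natrM natr_absz ltr0_norm // mulNr !mulrNz intrM -zE -tE xC xE.
by ring.
Qed.

(** Dividing an ideal by a nonzero element of least absolute value gives a representative [J] of its
    class that contains 1 and has no nonzero element in the open unit disc. Such a [J] lies between
    the ring of integers and a fixed multiple of it, which leaves finitely many choices. *)
Lemma class_group_finite (d : int) :
  d < 0 -> finite_set (class_group (quadratic_field d)).
Proof.
move=> d_lt0; have [M approxM] := quadratic_approximation d_lt0.
have R_gt0 : (0 < 2 * `|d| * M`!)%N by rewrite !muln_gt0 fact_gt0; lia.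
set w : algC := sqrtC d%:~R.
(* [R.+1] clears the denominators of all coordinates in [J]: the factorial of [M] takes care of the
   multipliers [m <= M], and [2 |d|] of the coordinates of integers. *)
case RE: (2 * `|d| * M`!)%N R_gt0 => [//|R] _.
pose r (u : int) : 'I_R.+1 := inord `|(u %% R.+1)%Z|%N.
pose L (S : {set 'I_R.+1 * 'I_R.+1}) : set algC :=
  [set z | exists u v : int, R.+1%:R * z = u%:~R + v%:~R * w /\ (r u, r v) \in S].
have R0 : R.+1%:R != 0 :> algC by rewrite pnatr_eq0.
have rE u : exists q : int, u = q * R.+1 + r u.
  exists (u %/ R.+1)%Z; rewrite inordK; last by lia.
  by rewrite {1}(divz_eq u R.+1) gez0_abs // modz_ge0.
(* [L S] need not be an ideal for every [S]; it is enough that each ideal class occurs in this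
   finite family. *)
apply: (@sub_finite_set _ _ [set ideal_class (quadratic_field d) (L S) | S in setT]);
  last exact/finite_image/finite_finset.
move=> _ [I fI <-]; have [x [Ix x0 minx]] := fractional_ideal_minimal d_lt0 fI.
have [IK _ _ _ _] := fI; have Kx := IK _ Ix.
have xV0 : x^-1 != 0 by rewrite invr_eq0.
rewrite -(ideal_class_scale I d_lt0 (quadratic_fieldV d_lt0 Kx) xV0).
have fJ := fractional_ideal_scale d_lt0 (quadratic_fieldV d_lt0 Kx) xV0 fI.
set J := [set x^-1 * _ | _ in I] in fJ *.
have J1 : J 1 by exists x; rewrite ?mulVf.
have Jsmall z : J z -> `|z| < 1 -> z = 0.
  move=> [y Iy <-] yx; rewrite (minx y) ?mulr0 //.
  by move: yx; rewrite normrM normfV mulrC ltr_pdivrMr ?normr_gt0 // mul1r.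
have [JK _ JD JM _] := fJ.
have OJ b : ring_of_integers (quadratic_field d) b -> J b.
  by move=> Ob; rewrite -[b]mulr1; apply: JM.
(* If an integer [b] is at distance less than 1 from [m z], then [m z - b] lies in [J] and vanishes
   by minimality. *)
have JO z : J z -> ring_of_integers (quadratic_field d) (M`!%:R * z).
  move=> Jz; have [m [b [/andP[m_gt0 mM] Ob mzb]]] := approxM z (JK _ Jz).
  have Jmz : J (m%:R * z) by apply: JM => //; apply: ring_of_integersz d m.
  have /eqP : m%:R * z - b = 0.
    apply: Jsmall => //; apply: JD => //; apply: (fractional_idealN fJ).
    exact: OJ.
  rewrite subr_eq0 => /eqP mzE.
  have /dvdnP[k ->] : (m %| M`!)%N by rewrite dvdn_fact // m_gt0.
  rewrite natrM -mulrA mzE; case: Ob => Kb Ab; split.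
    by apply: quadratic_fieldM => //; apply: quadratic_field_rat; rewrite rpred_nat.
  by rewrite rpredM ?rpred_nat.
pose S := [set ij : 'I_R.+1 * 'I_R.+1 |
  `[< J (R.+1%:R^-1 * (ij.1%:R + ij.2%:R * w)) >]]%SET.
exists S => //; congr ideal_class.
(* Changing [u] or [v] by a multiple of [R.+1] moves [z] by an element of [Z[w]], which is contained
   in [J], so only residues matter. *)
have key u v z : R.+1%:R * z = u%:~R + v%:~R * w -> J z <-> (r u, r v) \in S.
  move=> zE; have [q uE] := rE u; have [q' vE] := rE v.
  have Jq : J (q%:~R + q'%:~R * w) by apply/OJ/ring_of_integers_int.
  set y := R.+1%:R^-1 * ((r u)%:R + (r v)%:R * w).
  have zy : z = y + (q%:~R + q'%:~R * w).
    apply: (mulfI R0); rewrite mulrDr mulVKf // zE {1}uE {1}vE !intrD !intrM.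
    by rewrite -!pmulrn; ring.
  rewrite inE /= -/y; split=> [Jz|/asboolP Jy]; last by rewrite zy; apply: JD.
  apply/asboolP; have -> : y = z + - (q%:~R + q'%:~R * w) by rewrite zy addrK.
  by apply: JD => //; apply: (fractional_idealN fJ).
apply/seteqP; split=> z.
  by move=> [u [v [zE uvS]]]; apply/(key u v).
move=> Jz; have [u [v uvE]] := ring_of_integers_coordinates d_lt0 (JO z Jz).
have zE : R.+1%:R * z = u%:~R + v%:~R * w by rewrite -RE natrM -mulrA.
by exists u, v; split=> //; apply/(key u v z).
Qed.

(** * Units and [p]-th powers *)

(** A unit has norm and absolute value 1, so its trace [t] satisfies [|t| <= 2]. If [t = 0] then
    [u ^+ 2 = -1], and if [|t| = 2] then [u] is 1 or -1, whereas [t ^+ 2 = 1] would make [2 u - t] a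
    square root of -3. *)
Lemma imaginary_quadratic_unit (d : int) (u : algC) : d < 0 ->
  quadratic_field d u -> u \in Aint -> u^-1 \in Aint -> u != 0 ->
  (forall z, quadratic_field d z -> z ^+ 2 != -3) -> u ^+ 4 = 1.
Proof.
move=> d_lt0 Ku Au AuV u0 no_sqrt3.
have /intrP[n nE] := quadratic_integer_norm d_lt0 Ku Au.
have /intrP[n' nE'] :=
  quadratic_integer_norm d_lt0 (quadratic_fieldV d_lt0 Ku) AuV.
have n_ge0 : 0 <= n by rewrite -(ler0z algC) -nE mul_conjC_ge0.
have n1 : n = 1.
  have nn' : n * n' = 1.
    apply: (@intr_inj algC); rewrite intrM -nE -nE' fmorphV.
    by rewrite mulrACA !mulfV ?conjC_eq0 ?mulr1.
  have : (n %| n * n')%Z by rewrite dvdz_mulr.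
  by rewrite nn' dvdz1; lia.
have {}nE : u * u^* = 1 by rewrite nE n1.
have /intrP[t tE] := quadratic_integer_trace d_lt0 Ku Au.
have uE : u ^+ 2 = t%:~R * u - 1 by rewrite -tE; ring: nE.
have u_norm : `|u| = 1.
  by apply/eqP; rewrite -(@eqrXn2 _ 2) // normCK nE expr1n.
have t_le2 : `|t| <= 2.
  rewrite -(ler_int algC) intr_norm -tE (le_trans (ler_normD _ _)) //.
  by rewrite norm_conjC u_norm.
have {t_le2} : [|| t == 0, t ^+ 2 == 1 | t ^+ 2 == 4].
  by move: t_le2; nia.
case/or3P=> /eqP t2.
- rewrite t2 mul0r add0r in uE.
  by rewrite (exprM u 2 2) uE sqrrN expr1n.
- have /no_sqrt3/negP[] : quadratic_field d (2 * u - t%:~R).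
    apply: quadratic_fieldD; last by apply: quadratic_field_rat; rewrite rpredN rpred_int.
    by apply: quadratic_fieldM => //; apply: quadratic_field_rat; rewrite rpred_nat.
  have {}t2 : (t%:~R : algC) ^+ 2 = 1 by rewrite -rmorphXn /= t2.
  by apply/eqP; ring: uE t2.
- have {}t2 : (t%:~R : algC) ^+ 2 = 4 by rewrite -rmorphXn /= t2.
  have : (2 * u - t%:~R) ^+ 2 == 0 by apply/eqP; ring: uE t2.
  rewrite sqrf_eq0 subr_eq0 => /eqP u2.
  have u21 : u ^+ 2 = 1.
    apply: (@mulfI _ (4 : algC)); first by rewrite pnatr_eq0.
    by rewrite mulr1 -[RHS]t2 -u2; ring.
  by rewrite (exprM u 2 2) u21 expr1n.
Qed.

(* With [t] the trace of [g], the trace of [g ^+ p] is a multiple of [t] and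
   congruent to [t ^+ p * (1 - p V)] modulo [V ^+ 2] once [t ^+ 2 = 1]. *)
Lemma not_pth_power (d : int) (p V : nat) (g : algC) : d < 0 -> odd p ->
  (2 < p < V)%N -> quadratic_field d g -> g \in Aint ->
  g ^+ p + (g ^+ p)^* = 1 -> g ^+ p * (g ^+ p)^* = V%:R ^+ p -> False.
Proof.
move=> d_lt0 p_odd /andP[p_gt2 pV] Kg Ag; rewrite rmorphXn /= => tr_gp N_gp.
have /intrP[t tE] := quadratic_integer_trace d_lt0 Kg Ag.
have N_g : g * g^* = V%:R.
  apply/eqP; rewrite -(@eqrXn2 _ p) ?mul_conjC_ge0 ?ler0n //; last by lia.
  by rewrite exprMn N_gp.
(* The power sums of [g] and its conjugate form a Lucas sequence with parameters [t] and [V]. *)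
pose s k := g ^+ k + g^* ^+ k.
have sS k : s k.+2 = t%:~R * s k.+1 - V%:R * s k.
  by rewrite /s -tE -N_g !exprS; ring.
have s_int k : exists z : int, s k = z%:~R.
  suff [] : (exists z : int, s k = z%:~R) /\ (exists z : int, s k.+1 = z%:~R) by [].
  elim: k => [|k [[z zE] [z' zE']]].
    by split; [exists 2; rewrite /s !expr0|exists t; rewrite /s !expr1].
  split; first by exists z'.
  by exists (t * z' - V%:Z * z); rewrite sS zE zE' intrB !intrM -!pmulrn.
have s_odd k : exists z : int, s k.*2.+1 = (t * z)%:~R.
  elim: k => [|k [z zE]]; first by exists 1; rewrite mulr1 /s !expr1.
  have [z' zE'] := s_int k.*2.+2.
  exists (z' - V%:Z * z); rewrite doubleS sS zE zE'.
  by rewrite !(intrM, intrB) -!pmulrn; ring.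
have t2 : t ^+ 2 = 1.
  have [z] := s_odd p./2; have := odd_double_half p.
  rewrite p_odd add1n => ->; rewrite /s tr_gp => /esym/eqP.
  rewrite (eqr_int _ _ 1) => /eqP tz.
  have : (t %| t * z)%Z by rewrite dvdz_mulr.
  by rewrite tz dvdz1 => ?; have [->|->] : t = 1 \/ t = -1 by lia.
have t2C : (t%:~R : algC) ^+ 2 = 1 by rewrite -rmorphXn /= t2.
have s_mod k : exists z : int,
    s k.+2 = (t ^+ k.+2 * (1 - k.+2%:Z * V%:Z) + V%:Z ^+ 2 * z)%:~R.
  pose P k := exists z : int,
    s k.+2 = (t ^+ k.+2 * (1 - k.+2%:Z * V%:Z) + V%:Z ^+ 2 * z)%:~R.
  suff [] : P k /\ P k.+1 by [].
  have s1 : s 1 = t%:~R by rewrite /s !expr1.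
  have s2 : s 2 = t%:~R ^+ 2 - 2 * V%:R by rewrite sS s1 /s !expr0; ring.
  have castE (c : int) (m : nat) :
      (t ^+ m * (1 - m%:Z * V%:Z) + V%:Z ^+ 2 * c)%:~R =
      t%:~R ^+ m * (1 - m%:R * V%:R) + V%:R ^+ 2 * c%:~R :> algC.
    by rewrite !(intrD, mulrNz, intrM, rmorphXn) /= -!pmulrn; ring.
  elim: k => [|k [[z zE] [z' zE']]]; rewrite /P.
    split; exists 0; rewrite castE //; first by rewrite s2; ring: t2C.
    by rewrite sS s1 s2 !exprS expr0; ring: t2C.
  split; first by exists z'.
  (* The last summand collects the [V ^+ 2] term arising when [V] multiplies [k.+2 V]. *)
  exists (t * z' - V%:Z * z + t ^+ k * k.+2%:Z).
  rewrite castE // sS zE zE' !castE //.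
  rewrite !(intrD, mulrNz, intrM, rmorphXn) /= -!pmulrn !exprS -!natr1.
  by ring: t2C.
have [z] := s_mod p.-2; have -> : p.-2.+2 = p by lia.
rewrite /s tr_gp => /esym/eqP; rewrite (eqr_int _ _ 1) => /eqP.
have -> : t ^+ p = t.
  by rewrite -(odd_double_half p) p_odd exprD -muln2 mulnC exprM t2 expr1n mulr1.
(* For [t = 1] the congruence makes [p V] a multiple of [V ^+ 2], so [V] divides [p]; for [t = -1]
   it makes [V] divide 2. Both contradict [2 < p < V]. *)
have [-> E|tN1] : t = 1 \/ t = -1 by nia.
- have : (V %| p)%N.
    suff : V%:Z * z = p%:Z by move=> E'; apply/dvdnP; exists `|z|%N; nia.
    by nia.
  by move/dvdn_leq; lia.
- rewrite tN1 => E; have : (V %| 2)%N.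
    have : V%:Z * (p%:Z + V%:Z * z) = 2 by rewrite -[RHS]/(1 + 1) -{1}E; ring.
    by move/(congr1 absz); rewrite abszM => E2; rewrite -[2%N]/(absz 2) -E2 dvdn_mulr.
  by move/dvdn_leq; lia.
Qed.

(** * Permutations of prime order without fixed points *)

(** Transported to ['I_h], the map [f] generates a [p]-group of permutations. Its number of fixed
    points is congruent to [h] modulo [p], and there are none. *)
Lemma dvdn_card_set (T : Type) (A : set T) (f : T -> T) (p h : nat) :
  prime p -> (A #= `I_h)%card -> (forall x, A x -> A (f x)) ->
  (forall x, A x -> iter p f x = x) -> (forall x, A x -> f x <> x) ->
  (p %| h)%N.
Proof.
move=> p_pr /card_set_bijP[g [gA g_inj g_surj]] fA fp f_free.
have /choice[e eP] : forall i : 'I_h, exists x, A x /\ g x = i.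
  by move=> i; have [x Ax gx] := g_surj i (ltn_ord i); exists x.
have g_lt i : (g (f (e i)) < h)%N by apply/gA/fA; case: (eP i).
pose F i := Ordinal (g_lt i).
have eF i : e (F i) = f (e i).
  have [Ax gx] := eP (F i); apply: g_inj; rewrite ?inE //.
  by apply: fA; case: (eP i).
have e_inj i j : e i = e j -> i = j.
  move=> eij; apply: val_inj; have [_ /= <-] := eP i; have [_ /= <-] := eP j.
  by rewrite eij.
have iterF n i : e (iter n F i) = iter n f (e i).
  by elim: n => // n IHn; rewrite !iterS eF IHn.
have Fp i : iter p F i = i by apply: e_inj; rewrite iterF fp //; case: (eP i).
have F_inj : injective F.
  move=> i j Fij; rewrite -(Fp i) -(Fp j).
  by rewrite -(prednK (prime_gt0 p_pr)) !iterSr Fij.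
pose s := perm F_inj.
have sp : (s ^+ p = 1)%g.
  by apply/permP => i; rewrite permX perm1 -[RHS]Fp; apply: eq_iter => j; rewrite permE.
have pG : (p.-group <[s]>)%g.
  by rewrite /pgroup -orderE (pnat_dvd _ (pnat_id p_pr)) // order_dvdn sp.
have sT : [acts <[s]>%g, on [set: 'I_h]%SET | 'P].
  by apply/actsP => x _ i; rewrite !finset.in_setT.
have fix0 : ('Fix_([set: 'I_h]%SET | 'P)(<[s]>) = finset.set0)%g.
  apply/finset.setP => i; rewrite finset.in_setI finset.in_setT finset.in_set0 /=.
  apply/negP => /afixP fix_i; have := fix_i s (cycle_id s).
  rewrite /= apermE permE => /(congr1 e).
  by rewrite eF => /f_free; case; case: (eP i).
have := pgroup_fix_mod pG sT.
by rewrite fix0 cardsT card_ord cards0 mod0n => /eqP.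
Qed.

(** * Square roots of integers in quadratic fields *)

(** A square root [z] of a negative integer is purely imaginary, so its rational part vanishes and
    [z = b sqrt(d)], with [b = n / m] in lowest terms. *)
Lemma quadratic_field_sqrt_int (d e : int) (z : algC) : d < 0 -> e < 0 ->
  quadratic_field d z -> z ^+ 2 = e%:~R ->
  exists n m : int, [/\ m != 0, coprimez n m & n ^+ 2 * d = e * m ^+ 2].
Proof.
move=> d_lt0 e_lt0 /quadratic_fieldE[a [b' [Qa Qb zE]]] z2; set w := sqrtC _ in zE.
have w2 : w ^+ 2 = d%:~R := sqrtCK _.
have wC : w^* = - w := conj_sqrtC_neg d_lt0.
have zC : z^* = a - b' * w.
  by rewrite zE rmorphD rmorphM /= wC !conj_Crat // mulrN.
have zN : z^* = - z.
  have : z^* ^+ 2 == z ^+ 2 by rewrite -rmorphXn z2 rmorph_int.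
  rewrite eqf_sqr => /orP[/eqP z_real|/eqP //].
  have : z ^+ 2 < 0 by rewrite z2 ltrz0.
  by rewrite real_exprn_even_lt0 // CrealE z_real eqxx.
have a0 : a = 0.
  apply: (@mulfI _ (2 : algC)); first by rewrite pnatr_eq0.
  have : z^* + z = 0 by rewrite zN addNr.
  by rewrite mulr0 zC zE => z0; rewrite -z0; ring.
have /CratP[b bE] := Qb.
have b2 : b ^+ 2 * d%:~R = e%:~R.
  apply: (fmorph_inj (@ratr algC)); rewrite rmorphM rmorphXn /= !ratr_int.
  by rewrite -z2 zE a0 bE; ring: w2.
exists (numq b), (denq b); split; rewrite ?denq_eq0 //.
  by rewrite coprimezE; apply: coprime_num_den.
apply: (@intr_inj rat); rewrite !intrM numqE -b2 -!expr2; ring.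
Qed.

(** Such a root would give [n ^ 2 |d| = 3 m ^ 2] with [n] and [m] coprime; as 3 does not divide [d],
    it divides [n], and then [m]. *)
Lemma no_sqrtN3 (d : int) (z : algC) : d < 0 -> ~~ (3 %| d)%Z ->
  quadratic_field d z -> z ^+ 2 != -3.
Proof.
move=> d_lt0 d3 Kz; apply/eqP => z2.
have [||n [m [m0 nm E]]] := @quadratic_field_sqrt_int d (- 3) z d_lt0 _ Kz => //.
have pr3 : prime 3 by [].
have {E} E : (`|n| ^ 2 * `|d| = 3 * `|m| ^ 2)%N.
  by rewrite -!mulnn; have := congr1 absz E; rewrite !abszM.
have n3 : (3 %| `|n|)%N.
  have : (3 %| `|n| ^ 2 * `|d|)%N by rewrite E dvdn_mulr.
  by rewrite Euclid_dvdM // Euclid_dvdX // andbT => /orP[//|d3']; case/negP: d3.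
have m3 : (3 %| `|m|)%N.
  have : (3 * 3 %| 3 * `|m| ^ 2)%N by rewrite -E dvdn_mulr // -mulnn dvdn_mul.
  by rewrite dvdn_pmul2l // Euclid_dvdX // andbT.
have : (3 %| gcdn `|n| `|m|)%N by rewrite dvdn_gcd n3 m3.
by move: nm; rewrite coprimezE /coprime => /eqP ->.
Qed.

(** * The action of a two-generated ideal and divisibility of the class number *)

(** For a fractional ideal [J] and integers [a], [b] of the field, this is the product of [J] by the
    ideal [(a, b)], written without general products of ideals. *)
Definition two_generated (a b : algC) (J : set algC) : set algC :=
  [set z | exists x y, [/\ J x, J y & z = a * x + b * y]].

Lemma two_generated_scale (a b c : algC) (J : set algC) :
  two_generated a b [set c * x | x in J] =
  [set c * x | x in two_generated a b J].
Proof.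
apply/seteqP; split.
  move=> z [_ [_ [[x Jx <-] [y Jy <-] ->]]].
  by exists (a * x + b * y); [exists x, y|ring].
move=> _ [z [x [y [Jx Jy ->]]] <-].
by exists (c * x), (c * y); split; [exists x|exists y|ring].
Qed.

Lemma two_generated_fractional_ideal (d : int) (a b : algC) (J : set algC) :
  ring_of_integers (quadratic_field d) a ->
  ring_of_integers (quadratic_field d) b -> b != 0 ->
  fractional_ideal (quadratic_field d) J ->
  fractional_ideal (quadratic_field d) (two_generated a b J).
Proof.
move=> Oa Ob b0 [JK [j Jj j0] JD JM [c [Oc c0 cJ]]].
have sub z : two_generated a b J z -> J z.
  by move=> [x [y [Jx Jy ->]]]; apply: JD; apply: JM.
have J0 : J 0 by rewrite -(mul0r j); apply: JM => //; apply: ring_of_integersz d 0.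
split.
- by move=> z /sub /JK.
- exists (b * j); last by rewrite mulf_neq0.
  by exists 0, j; split=> //; rewrite mulr0 add0r.
- move=> _ _ [x [y [Jx Jy ->]]] [x' [y' [Jx' Jy' ->]]].
  by exists (x + x'), (y + y'); split; [exact: JD|exact: JD|ring].
- move=> e _ Oe [x [y [Jx Jy ->]]].
  by exists (e * x), (e * y); split; [exact: JM|exact: JM|ring].
- by exists c; split=> // z /sub /cJ.
Qed.

(* If [a + a' = 1] and [a a' = V ^+ p], then [I := (a, V)] satisfies
   [I ^+ k = (a, V ^+ k)] for [k <= p], hence [I ^+ p = (a)]. *)
Lemma iter_two_generated (d : int) (a a' : algC) (V p : nat) (J : set algC) :
  ring_of_integers (quadratic_field d) a ->
  ring_of_integers (quadratic_field d) a' -> a + a' = 1 ->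
  a * a' = V%:R ^+ p -> fractional_ideal (quadratic_field d) J -> (0 < p)%N ->
  iter p (two_generated a V%:R) J = [set a * x | x in J].
Proof.
move=> Oa Oa' tr_a N_a [JK [j Jj j0] JD JM _] p_gt0.
have JMn n x : J x -> J (V%:R ^+ n * x).
  by move=> Jx; apply: JM => //; rewrite -natrX; apply: ring_of_integersz d (V ^ n)%N.
have iterE k : (k < p)%N ->
    iter k.+1 (two_generated a V%:R) J = two_generated a (V%:R ^+ k.+1) J.
  elim: k => [|k IHk] kp; first by rewrite expr1.
  rewrite iterS IHk ?(ltnW kp) //; apply/seteqP; split.
    move=> _ [_ [_ [[x [y [Jx Jy ->]]] [x' [y' [Jx' Jy' ->]]] ->]]].
    exists (a * x + V%:R ^+ k.+1 * y + V%:R ^+ 1 * x'), y'; split=> //.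
      by apply/JD; [apply/JD; [exact: JM|exact: JMn]|exact: JMn].
    by rewrite !exprS expr0; ring.
  move=> _ [x [y [Jx Jy ->]]].
  (* The witnesses come from [a x = a ^+ 2 x + a a' x], in which
     [a a' = V ^+ k.+2 * V ^+ (p - k.+2)] is absorbed by the second generator. *)
  exists (a * x + V%:R ^+ k.+1 * 0), (a * 0 + V%:R ^+ k.+1 * (V%:R ^+ (p - k.+2) * x + y)).
  have J0 : J 0 by rewrite -(mul0r j); apply: JM => //; apply: ring_of_integersz d 0.
  split; [by exists x, 0| |].
    by exists 0, (V%:R ^+ (p - k.+2) * x + y); split=> //; apply: JD => //; apply: JMn.
  have Np : V%:R ^+ k.+2 * V%:R ^+ (p - k.+2) = a * a' by rewrite -exprD subnKC.
  have ax : a * x = a * a * x + V%:R ^+ k.+2 * V%:R ^+ (p - k.+2) * x.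
    by rewrite Np -mulrDl -mulrDr tr_a mulr1.
  by rewrite [in LHS]ax exprS; ring.
have := iterE p.-1; rewrite prednK // => -> //; apply/seteqP; split.
  move=> _ [x [y [Jx Jy ->]]]; exists (x + a' * y); last by rewrite -N_a; ring.
  by apply: JD => //; apply: JM.
move=> _ [x Jx <-]; exists x, 0; split=> //; last by ring.
by rewrite -(mul0r j); apply: JM => //; apply: ring_of_integersz d 0.
Qed.

Lemma class_number_dvd (p V : nat) : prime p -> odd p -> (p < V)%N ->
  (V %% 3 != 1)%N ->
  class_number_divisible_by p (quadratic_field (1 - 4 * V%:Z ^+ p)).
Proof.
move=> p_pr p_odd pV V3; set d : int := 1 - _.
have p_gt2 : (2 < p)%N by case: p p_pr p_odd {pV d} => [|[|[|]]].
have Vp_gt0 : 0 < V%:Z ^+ p by apply: exprn_gt0; lia.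
have d_lt0 : d < 0 by rewrite /d; lia.
(* [V] is 0 or 2 modulo 3, and so is [V ^+ p] because [p] is odd; hence [d], congruent to
   [1 - V ^+ p], is not 0 modulo 3. *)
have d3 : ~~ (3 %| d)%Z.
  have VE n : V%:Z ^+ n = (V ^ n)%N%:Z.
    by elim: n => // n IHn; rewrite exprS expnS PoszM IHn.
  have : (V ^ p %% 3 != 1)%N.
    rewrite -modnXm; move: V3 (ltn_pmod V (isT : 0 < 3)%N).
    case: (V %% 3)%N => [|[|[|]]] // _ _; first by rewrite exp0n ?mod0n //; lia.
    have pow2 n : (2 ^ n.*2.+1 %% 3 = 2)%N.
      by elim: n => // n; rewrite doubleS !expnS; lia.
    by rewrite -(odd_double_half p) p_odd add1n pow2.
  by rewrite /d VE; move: (V ^ p)%N => v; lia.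
have w2 := sqrtCK (d%:~R : algC); have wC := conj_sqrtC_neg d_lt0.
pose a : algC := (1 + sqrtC d%:~R) / 2; pose a' : algC := (1 - sqrtC d%:~R) / 2.
have aC : a^* = a'.
  by rewrite /a fmorph_div rmorphD rmorph1 /= wC conjC_nat.
have tr_a : a + a' = 1 by rewrite /a /a'; field.
have N_a : a * a' = V%:R ^+ p.
  have dE : d%:~R = 1 - 4 * V%:R ^+ p :> algC.
    by rewrite /d intrB intrM rmorphXn /= -!pmulrn.
  have w2' : sqrtC d%:~R ^+ 2 = 1 - 4 * V%:R ^+ p :> algC by rewrite w2.
  by rewrite /a /a'; field: w2'.
have V0 : V%:R != 0 :> algC by rewrite pnatr_eq0; lia.
have a0 : a != 0.
  by apply: contraTneq (expf_neq0 p V0) => aE; rewrite -N_a aE mul0r eqxx.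
have Qh : (2^-1 : algC) \in Crat by rewrite rpredV rpred_nat.
have Q1 : quadratic_field d 1 by case: (ring_of_integers1 d).
have Ka : quadratic_field d a.
  apply: quadratic_fieldM; last exact: quadratic_field_rat.
  by apply: quadratic_fieldD => //; apply: quadratic_field_sqrt.
have Aa : a \in Aint.
  by apply: Aint_trace_norm; rewrite aC ?tr_a ?N_a ?rpred1 // rpredX ?rpred_nat.
have Oa : ring_of_integers (quadratic_field d) a by [].
have Oa' : ring_of_integers (quadratic_field d) a'.
  by rewrite -aC; split; [exact: quadratic_field_conj|rewrite Aint_aut].
have OV : ring_of_integers (quadratic_field d) V%:R := ring_of_integersz d V.
pose T := two_generated a V%:R.
have /finite_setP[h hE] := class_group_finite d_lt0.
exists h => //.
(* [T] commutes with scaling, so taking images under [T] maps ideal classes to ideal classes. *)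
have TE J : [set T I | I in ideal_class (quadratic_field d) J] =
    ideal_class (quadratic_field d) (T J).
  apply/seteqP; split.
    by move=> _ [_ [c [Kc c0 ->]] <-]; exists c; split=> //; apply: two_generated_scale.
  move=> _ [c [Kc c0 ->]]; exists [set c * x | x in J]; first by exists c.
  exact: two_generated_scale.
have fT J : fractional_ideal (quadratic_field d) J ->
    fractional_ideal (quadratic_field d) (T J).
  exact: two_generated_fractional_ideal.
apply: (@dvdn_card_set _ _ (fun C => [set T I | I in C]) _ _ p_pr hE).
- by move=> _ [J fJ <-]; exists (T J); [exact: fT|rewrite TE].
- move=> _ [J fJ <-]; rewrite -[RHS](ideal_class_scale J d_lt0 Ka a0).
  rewrite -(iter_two_generated Oa Oa' tr_a N_a fJ (prime_gt0 p_pr)) -/T.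
  suff iterTE k : iter k (fun C => [set T I | I in C])
      (ideal_class (quadratic_field d) J) = ideal_class (quadratic_field d) (iter k T J).
    exact: iterTE.
  by elim: k => // k IHk; rewrite !iterS IHk TE.
move=> _ [J fJ <-]; rewrite TE => TJ.
have [c [Kc c0 TJc]] : ideal_class (quadratic_field d) J (T J).
  rewrite -TJ; exists 1; split; rewrite ?oner_neq0 //.
  by rewrite -[LHS]image_id; apply: eq_imagel => x _; rewrite mul1r.
have iterT k : iter k T J = [set c ^+ k * x | x in J].
  elim: k => [|k IHk].
    by rewrite -[LHS]image_id; apply: eq_imagel => x _; rewrite mul1r.
  rewrite iterS IHk {1}/T two_generated_scale -/T TJc image_comp.
  by apply: eq_imagel => x _ /=; rewrite mulrA -exprSr.
have aJ : [set a * x | x in J] = [set c ^+ p * x | x in J].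
  rewrite -iterT.
  by rewrite -(iter_two_generated Oa Oa' tr_a N_a fJ (prime_gt0 p_pr)).
have cp0 : c ^+ p != 0 by rewrite expf_neq0.
pose u := a / c ^+ p.
have Ku : quadratic_field d u.
  by apply: quadratic_fieldM => //; apply/quadratic_fieldV/quadratic_fieldX.
have u0 : u != 0 by rewrite mulf_neq0 ?invr_eq0.
have Au : u \in Aint.
  apply: (fractional_ideal_stabilizer d_lt0 fJ Ku) => x Jx.
  have : [set a * x | x in J] (a * x) by exists x.
  by rewrite aJ => -[y Jy cy]; rewrite /u mulrAC -cy mulrAC divff // mul1r.
have AuV : u^-1 \in Aint.
  apply: (fractional_ideal_stabilizer d_lt0 fJ (quadratic_fieldV d_lt0 Ku)) => x Jx.
  have : [set c ^+ p * x | x in J] (c ^+ p * x) by exists x.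
  by rewrite -aJ => -[y Jy ay]; rewrite /u invf_div mulrAC -ay mulrAC divff // mul1r.
have u4 := imaginary_quadratic_unit d_lt0 Ku Au AuV u0 (fun z => no_sqrtN3 d_lt0 d3).
(* As [p] is odd, [p * p] is 1 modulo 4; with [u ^+ 4 = 1] this makes [u] the [p]-th power of
   [u ^+ p]. *)
pose g := u ^+ p * c.
have gp : g ^+ p = a.
  have p4 : (p * p = 4 * (p * p %/ 4) + 1)%N.
    by have := odd_double_half p; rewrite p_odd; nia.
  rewrite exprMn -exprM p4 exprD exprM u4 expr1n mul1r expr1.
  by rewrite /u divfK.
have Kg : quadratic_field d g.
  by apply: quadratic_fieldM => //; apply: quadratic_fieldX.
have Ag : g \in Aint by apply: (@Aint_root_exp _ p); rewrite ?prime_gt0 ?gp.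
apply: (@not_pth_power d p V g) => //; first by rewrite p_gt2.
  by rewrite gp aC.
by rewrite gp aC.
Qed.

(** * Infinitely many pairs of fields *)

Lemma quadratic_field_sqr (d s : int) : s != 0 ->
  quadratic_field (s ^+ 2 * d) = quadratic_field d.
Proof.
move=> s0; have sC0 : (s%:~R : algC) != 0 by rewrite intr_eq0.
have : (sqrtC (s ^+ 2 * d)%:~R : algC) ^+ 2 == (s%:~R * sqrtC d%:~R) ^+ 2.
  by rewrite exprMn !sqrtCK intrM rmorphXn.
have Qs : (s%:~R : algC) \in Crat by rewrite rpred_int.
rewrite eqf_sqr => sqrt_eq.
have [e [Qe e0 eE]] : exists e : algC, [/\ e \in Crat, e != 0 &
    sqrtC (s ^+ 2 * d)%:~R = e * sqrtC d%:~R].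
  case/orP: sqrt_eq => /eqP ->; first by exists s%:~R.
  by exists (- s%:~R); rewrite rpredN oppr_eq0 mulNr.
apply/seteqP; split=> _ /quadratic_fieldE[a [b [Qa Qb ->]]]; apply/quadratic_fieldE.
  by exists a, (b * e); rewrite rpredM // eE mulrA.
by exists a, (b / e); rewrite rpredM ?rpredV // eE mulrA divfK.
Qed.

Lemma exprD_mod_sqr (a x n : nat) :
  exists c, ((a + x) ^ n.+1 = a ^ n.+1 + n.+1 * a ^ n * x + c * x ^ 2)%N.
Proof.
elim: n => [|n [c E]]; first by exists 0%N; rewrite !expn1 expn0; lia.
exists (n.+1 * a ^ n + c * a + c * x)%N; rewrite expnS E !expnS.
by move: (a ^ n)%N => A; ring.
Qed.

(* A prime [q] dividing [4 W ^ p - 1] with [W] a factorial is large; replacing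
   [W] by [W + 3 q] removes a second factor [q] if there is one. *)
Lemma exists_exact_prime_divisor (p N : nat) : prime p ->
  exists V q : nat, [/\ prime q, (N < q)%N, (p < V)%N, (3 %| V)%N &
    logn q (4 * V ^ p - 1) = 1%N].
Proof.
move=> p_pr; have p_gt0 := prime_gt0 p_pr.
have [W W_dvd W_gt0] : exists2 W, forall k, (0 < k <= N + p + 3)%N -> (k %| W)%N &
    (0 < W)%N.
  (* The summand 3 makes 3 divide [W] and forces [q > 3] below. *)
  by exists (N + p + 3)`!; [move=> k; apply: dvdn_fact|apply: fact_gt0].
have W_ge : (N + p + 3 <= W)%N.
  by rewrite dvdn_leq // W_dvd // leqnn andbT addnS.
have Wp : (W <= W ^ p)%N by rewrite -{1}[W]expn1 leq_pexp2l.
have Wp_gt1 : (1 < 4 * W ^ p - 1)%N by move: (W ^ p)%N Wp => A; lia.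
have Wp4 : (0 < 4 * W ^ p)%N by rewrite muln_gt0 expn_gt0 W_gt0.
have [q q_pr q_dvd] := pdivP Wp_gt1.
have qW : ~~ (q %| W)%N.
  apply/negP => qW; have : (q %| 4 * W ^ p)%N.
    by rewrite dvdn_mull // (dvdn_trans qW) // dvdn_exp.
  rewrite (_ : 4 * W ^ p = 4 * W ^ p - 1 + 1)%N; last by rewrite subnK.
  by rewrite dvdn_addr // dvdn1 => /eqP q1; rewrite q1 in q_pr.
have q_gt : (N + p + 3 < q)%N.
  by rewrite ltnNge; apply: contra qW => q_le; rewrite W_dvd // q_le prime_gt0.
have W3 : (3 %| W)%N by rewrite W_dvd //; lia.
have [Nq pq] : (N < q)%N /\ (p < q)%N by move: q_gt; clear; lia.
have [q_gt3 pW] : (3 < q)%N /\ (p < W)%N by move: q_gt W_ge; clear; lia.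
have exact_log V : (q %| 4 * V ^ p - 1)%N -> ~~ (q ^ 2 %| 4 * V ^ p - 1)%N ->
    logn q (4 * V ^ p - 1) = 1%N.
  move=> qV q2V; have pos : (0 < 4 * V ^ p - 1)%N.
    by case: (posnP (4 * V ^ p - 1)%N) q2V => // ->; rewrite dvdn0.
  move: qV q2V; rewrite -{1}[q]expn1 !pfactor_dvdn // -ltnNge => ? ?.
  by apply/eqP; rewrite eqn_leq; apply/andP.
have [q2|q2] := boolP (q ^ 2 %| 4 * W ^ p - 1)%N; last first.
  by exists W, q; split=> //; exact: exact_log.
have [c] := exprD_mod_sqr W (3 * q) p.-1; rewrite prednK // => E.
pose V := (W + 3 * q)%N.
(* Modulo [q ^ 2] the shift by [3 q] adds [q * (12 * p * W ^ p.-1)], and [q] divides none of 12, [p]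
   and [W]. The factor 3 keeps [V] divisible by 3. *)
have E1 : (4 * V ^ p - 1 =
    4 * W ^ p - 1 + q * (12 * p * W ^ p.-1) + q ^ 2 * (36 * c))%N.
  have -> : (4 * V ^ p = 4 * W ^ p + q * (12 * p * W ^ p.-1) + q ^ 2 * (36 * c))%N.
    by rewrite E; ring.
  by rewrite addnBAC // addnBAC // addn_gt0 Wp4.
exists V, q; split=> //; [exact: ltn_addr|by rewrite dvdn_add // dvdn_mulr|].
apply: exact_log; rewrite E1.
  by rewrite !dvdn_add ?dvdn_mulr // expnS dvdn_mulr.
rewrite (dvdn_addl _ (dvdn_mulr _ (dvdnn _))) (dvdn_addr _ q2) -mulnn dvdn_pmul2l ?prime_gt0 //.
rewrite !Euclid_dvdM // Euclid_dvdX // !negb_or negb_and qW /= andbT.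
rewrite (@gtnNdvd p) // andbT -[12%N]/(2 * 2 * 3)%N !Euclid_dvdM // !negb_or.
by rewrite !(@gtnNdvd _ q) // ltnW.
Qed.

Theorem theorem4 (p : nat) (p_prime : prime p) (p_odd : odd p)
    (p_ge3 : (3 <= p)%N) :
  infinite_set
    [set (quadratic_field d, quadratic_field (d + 1)) | d in
      [set d : int | [/\ d < 0, d + 1 < 0,
         class_number_divisible_by p (quadratic_field d) &
         class_number_divisible_by p (quadratic_field (d + 1))]]].
Proof.
set A := (X in infinite_set X) => finA.
(* [f] records [|d|] for a negative [d] defining the first field of a pair. If [A] is finite these
   values are bounded, and [q] is taken beyond all of them. *)
have /choice[f fP] : forall P, exists n : nat, A P ->
    exists2 d : int, d < 0 /\ `|d|%N = n & P.1 = quadratic_field d.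
  move=> P; have [[d [d_lt0 _ _ _] <-]|nAP] := pselect (A P); last by exists 0%N.
  by exists `|d|%N => _; exists d.
have /finite_seqP[s sE] := finite_image f finA.
have [V [q [q_pr q_gt pV V3 logU]]] :=
  exists_exact_prime_divisor (\max_(n <- s) n) p_prime.
have p_gt0 := prime_gt0 p_prime.
have [V_gt0 Vp] : (0 < V)%N /\ (V <= V ^ p)%N.
  have V_gt0 : (0 < V)%N by apply: leq_ltn_trans pV.
  by rewrite -{2}[V]expn1 leq_pexp2l.
have [U UV] : exists U, (U.+1 = 4 * V ^ p)%N.
  by exists (4 * V ^ p).-1; rewrite prednK // muln_gt0 expn_gt0 V_gt0.
have {}logU : logn q U = 1%N by rewrite -logU -UV subn1.
have pU : (p < U)%N by move: (V ^ p)%N Vp UV => v; lia.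
have U_gt0 : (0 < U)%N by apply: leq_ltn_trans pU.
have Up : (0 < U ^ p)%N by rewrite expn_gt0 U_gt0.
have PoszX (a n : nat) : (a ^ n)%N%:Z = a%:Z ^+ n.
  by elim: n => // n IHn; rewrite exprS expnS PoszM IHn.
have UE : - U%:Z = 1 - 4 * V%:Z ^+ p by rewrite -PoszX; move: (V ^ p)%N UV => v; lia.
pose d : int := - 4 * U%:Z ^+ p.
have dE : quadratic_field d = quadratic_field (- U%:Z).
  (* Since [p] is odd, [U ^+ p] is [U] times the square of [U ^+ p./2]. *)
  have -> : d = (2 * U%:Z ^+ p./2) ^+ 2 * - U%:Z.
    rewrite /d -{1}(odd_double_half p) p_odd -muln2 exprD exprM expr1.
    by ring.
  by rewrite quadratic_field_sqr // mulf_neq0 // expf_neq0 // -lt0n.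
have AP : A (quadratic_field d, quadratic_field (d + 1)).
  exists d => //; split; rewrite ?dE ?UE.
  - by rewrite /d -PoszX; move: (U ^ p)%N Up => v; lia.
  - by rewrite /d -PoszX; move: (U ^ p)%N Up => v; lia.
  - by apply: class_number_dvd => //; move: V3; rewrite /dvdn => /eqP ->.
  - rewrite (_ : d + 1 = 1 - 4 * U%:Z ^+ p); last by rewrite /d; ring.
    apply: class_number_dvd => //.
    (* [U = 4 V ^ p - 1] is 2 modulo 3 because 3 divides [V]. *)
    have : (3 %| V ^ p)%N by rewrite (dvdn_trans V3) // dvdn_exp.
    by move: (V ^ p)%N UV => v; lia.
have [e [e_lt0 eE] /= Kde] := fP _ AP.
have e_q : (`|e| < q)%N.
  apply: leq_ltn_trans q_gt; rewrite eE; apply: leq_bigmax_seq => //.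
  by have : [set` s] (f (quadratic_field d, quadratic_field (d + 1)))
    by rewrite -sE; exists (quadratic_field d, quadratic_field (d + 1)).
have NU_lt0 : - U%:Z < 0 by rewrite oppr_lt0.
(* Equality of the fields puts a square root of [- U] in [Q(sqrt(e))]. In the resulting equation
   [n ^ 2 |e| = U m ^ 2] the [q]-adic valuation is even on the left, as [0 < |e| < q], and odd on
   the right. *)
have := quadratic_field_sqrt (- U%:Z); rewrite -dE Kde.
move=> /(quadratic_field_sqrt_int e_lt0 NU_lt0) /(_ (sqrtCK _)) [n [m [m0 _ E]]].
have {E} E : (`|n| ^ 2 * `|e| = U * `|m| ^ 2)%N.
  by rewrite -!mulnn; have := congr1 absz E; rewrite !abszM abszN.
have e_gt0 : (0 < `|e|)%N by lia.
have m_gt0 : (0 < `|m|)%N by lia.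
have n_gt0 : (0 < `|n|)%N.
  have : (0 < U * `|m| ^ 2)%N by rewrite muln_gt0 U_gt0 expn_gt0 m_gt0.
  by rewrite -E muln_gt0 expn_gt0 => /andP[/orP[]].
have := congr1 (logn q) E; rewrite !lognM ?expn_gt0 ?n_gt0 ?m_gt0 // logU.
rewrite (@logn_coprime q `|e|); first by clear; lia.
by rewrite prime_coprime // gtnNdvd.
Qed.
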